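(* Let $C\ge2$, let $\lambda_1>\lambda_2>\cdots>\lambda_{C-1}>0$ be given constants, let $n_1,n_2\ge1$ be fixed integers, and let $\alpha\in(0,1)$. Let $\mathbf{X}_1=(X_{11},\dots,X_{1C})$ and $\mathbf{X}_2=(X_{21},\dots,X_{2C})$ be independent multinomial vectors with sample sizes $n_1,n_2$ and cell probability vectors $\mathbf{p}_1,\mathbf{p}_2$ (with strictly positive entries). Then the directed chi-square test (the test which rejects $H$ if and only if the conditional $P$-value of the directed chi-square statistic $\chi_D^2$ given the column totals is at most $\alpha$) is admissible for testing $H:\mathbf{p}_1=\mathbf{p}_2$ against the alternative $$K_{ICX}:\Big\{(\mathbf{p}_1,\mathbf{p}_2):\ \lambda_r\sum_{j=1}^{r}(p_{1j}-p_{2j})+\sum_{j=r+1}^{C-1}\lambda_j(p_{1j}-p_{2j})\ge0,\ r=1,\dots,C-1\Big\}\setminus H.$$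
   Context: The sample is the $2\times C$ table $\mathbf{x}=(x_{ij})$, $i=1,2$, $j=1,\dots,C$, of nonnegative integers with row totals $\sum_j x_{ij}=n_i$; column totals are $t_j=x_{1j}+x_{2j}$. For a real table $\mathbf{d}=(d_{ij})\in\mathbb{R}^{2C}$, define the closed convex cone $\mathcal{C}$ as the set of all $\mathbf{d}$ with $d_{1j}+d_{2j}=0$ for $j=1,\dots,C$, $\sum_{j=1}^{C}d_{ij}=0$ for $i=1,2$, and $$\lambda_r\sum_{j=1}^{r}\Big(\frac{d_{1j}}{n_1}-\frac{d_{2j}}{n_2}\Big)+\sum_{j=r+1}^{C-1}\lambda_j\Big(\frac{d_{1j}}{n_1}-\frac{d_{2j}}{n_2}\Big)\ge0,\qquad r=1,\dots,C-1.$$ For a table $\mathbf{x}$ put $A(\mathbf{x})=\{\mathbf{u}\in\mathbb{R}^{2C}:\mathbf{u}-\mathbf{x}\in\mathcal{C}\}$. The directed chi-square statistic is $$\chi_D^2(\mathbf{x})=\inf_{\mathbf{u}\in A(\mathbf{x})}\sum_{i=1}^{2}\sum_{j=1}^{C}\frac{u_{ij}^2}{n_it_j},$$ where, if $t_j=0$, the term $u_{ij}^2/(n_it_j)$ is read as $0$ when $u_{ij}=0$ and $+\infty$ otherwise. Conditional $P$-value: given an observed table $\mathbf{x}_0$ with row totals $n_1,n_2$ and column totals $t_1,\dots,t_C$, it is the sum, over all tables $\mathbf{x}$ of nonnegative integers with these same row and column totals and with $\chi_D^2(\mathbf{x})\ge\chi_D^2(\mathbf{x}_0)$, of the conditional probability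 of $\mathbf{x}$ given the column totals under $H$. This conditional distribution under $H$ is multivariate hypergeometric and does not depend on the common value of $\mathbf{p}_1=\mathbf{p}_2$. A test function is a map $\phi$ from the sample space to $[0,1]$, with $\phi(\mathbf{x})$ the probability of rejecting $H$ at $\mathbf{x}$. A test $\phi$ is admissible for $H$ versus $K$ if there is no test $\phi'$ with $E_{\mathbf{p}}\phi'\le E_{\mathbf{p}}\phi$ for all $\mathbf{p}\in H$ and $E_{\mathbf{p}}\phi'\ge E_{\mathbf{p}}\phi$ for all $\mathbf{p}\in K$, with strict inequality for at least one $\mathbf{p}\in H\cup K$. *)

(* Defs.v *)
(* MathComp / MathComp-Analysis, over an arbitrary [R : realType].
   Everything is 0-based: the populations 1, 2 are the rows [0], [1] of type
   ['I_2], the cells 1..C are ['I_C], and lambda_1..lambda_{C-1} is indexed by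
   ['I_C.-1].  Both parameters (p_1, p_2) and real tables are matrices
   ['M[R]_(2, C)]. *)
From HB Require Import structures.
From mathcomp Require Import all_boot all_order all_algebra.
From mathcomp Require Import all_classical all_reals all_analysis.

Set Implicit Arguments.
Unset Strict Implicit.
Unset Printing Implicit Defensive.

Import Order.TTheory GRing.Theory Num.Theory.

Local Open Scope classical_set_scope.
Local Open Scope ring_scope.

(* An entry never exceeds its row total, so bounding the entries by
   n_1 + n_2 loses no table and makes the sample space a finite type. *)
Record sample (n : 'I_2 -> nat) (C : nat) := Sample {
  cells : 'M['I_(n 0%R + n 1%R).+1]_(2, C);
  _ : [forall i, (\sum_(j < C) (cells i j : nat))%N == n i]
}.
HB.instance Definition _ n C := [isSub for @cells n C].
HB.instance Definition _ n C := [Finite of sample n C by <:].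

Section Defs.
Context {R : realType} {C : nat}.
Implicit Types (n : 'I_2 -> nat) (lambda : 'I_C.-1 -> R).

Definition count_at n (x : sample n C) (i : 'I_2) (j : 'I_C) : nat :=
  cells x i j.

Definition coltot n (x : sample n C) (j : 'I_C) : nat :=
  (\sum_(i < 2) count_at x i j)%N.

Definition same_coltot n (x y : sample n C) : bool :=
  [forall j, coltot x j == coltot y j].

Definition real_table n (x : sample n C) : 'M[R]_(2, C) :=
  \matrix_(i, j) (count_at x i j)%:R.

(* lambda_r * (v_1 + ... + v_r) + sum_{j = r+1}^{C-1} lambda_j v_j *)
Definition icx_form lambda (r : 'I_C.-1) (v : 'I_C -> R) : R :=
  lambda r * (\sum_(j < C | (j <= r)%N) v j)
  + \sum_(j < C.-1 | (r < j)%N) lambda j * v (widen_ord (leq_pred C) j).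

Definition icx_cone n lambda : set 'M[R]_(2, C) :=
  [set d | [/\ forall j, d 0 j + d 1 j = 0,
               forall i, \sum_(j < C) d i j = 0
             & forall r, 0 <= icx_form lambda r
                 (fun j => d 0 j / (n 0)%:R - d 1 j / (n 1)%:R)]].

Definition upper_tables n lambda (x : sample n C) : set 'M[R]_(2, C) :=
  [set u | icx_cone n lambda (u - real_table x)].

Definition chi2_term n (x : sample n C) (u : 'M[R]_(2, C)) i j : \bar R :=
  if coltot x j == 0%N then (if u i j == 0 then 0%E else +oo%E)
  else (u i j ^+ 2 / ((n i)%:R * (coltot x j)%:R))%:E.

Definition directed_chi2 n lambda (x : sample n C) : \bar R :=
  ereal_inf [set (\sum_(i < 2) \sum_(j < C) chi2_term x u i j)%E
            | u in upper_tables lambda x].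

Definition cell_probs (p : 'M[R]_(2, C)) : Prop :=
  (forall i j, 0 < p i j) /\ (forall i, \sum_(j < C) p i j = 1).

Definition null_hyp : set 'M[R]_(2, C) :=
  [set p | cell_probs p /\ row 0 p = row 1 p].

Definition K_icx lambda : set 'M[R]_(2, C) :=
  [set p | cell_probs p /\
           forall r, 0 <= icx_form lambda r (fun j => p 0 j - p 1 j)]
  `\` null_hyp.

(* Joint mass function of two independent multinomial vectors. *)
Definition pmf n (p : 'M[R]_(2, C)) (x : sample n C) : R :=
  \prod_(i < 2) ((n i)`!%:R / (\prod_(j < C) (count_at x i j)`!%:R)
                 * \prod_(j < C) p i j ^+ count_at x i j).

Definition expect n (p : 'M[R]_(2, C)) (phi : sample n C -> R) : R :=
  \sum_(x : sample n C) pmf p x * phi x.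

(* Probability of [x] under [p], conditional on the column totals of [x]. *)
Definition cond_pmf n (p : 'M[R]_(2, C)) (x : sample n C) : R :=
  pmf p x / \sum_(y : sample n C | same_coltot y x) pmf p y.

(* [p] is meant to range over [null_hyp]; by [cond_pmf_null] below the value
   does not depend on which null parameter is used. *)
Definition pvalue n lambda (p : 'M[R]_(2, C)) (x0 : sample n C) : R :=
  \sum_(x : sample n C | same_coltot x x0 &&
      (directed_chi2 lambda x0 <= directed_chi2 lambda x)%E) cond_pmf p x.

Definition directed_chi2_test n lambda (p : 'M[R]_(2, C)) (alpha : R)
    (x : sample n C) : R :=
  if pvalue lambda p x <= alpha then 1 else 0.

Definition is_test n (phi : sample n C -> R) : Prop :=
  forall x, 0 <= phi x <= 1.

Definition admissible n (H K : set 'M[R]_(2, C)) (phi : sample n C -> R) :=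
  is_test phi /\
  ~ exists phi' : sample n C -> R,
      [/\ is_test phi',
          forall p, H p -> expect p phi' <= expect p phi,
          forall p, K p -> expect p phi <= expect p phi'
        & (exists2 p, H p & expect p phi' < expect p phi) \/
          (exists2 p, K p & expect p phi < expect p phi')].

Lemma cond_pmf_null n (p q : 'M[R]_(2, C)) (x : sample n C) :
  null_hyp p -> null_hyp q -> cond_pmf p x = cond_pmf q x.
Proof.
pose h (y : sample n C) : R :=
  \prod_(i < 2) ((n i)`!%:R / (\prod_(j < C) (count_at y i j)`!%:R)).
pose m (s : 'M[R]_(2, C)) : R := \prod_(j < C) s 0 j ^+ coltot x j.
have pmfE s y : null_hyp s -> same_coltot y x -> pmf s y = h y * m s.
  move=> [_ /rowP s01] /forallP yx; rewrite /pmf big_split /=; congr (_ * _).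
  rewrite exchange_big /=; apply: eq_bigr => j _.
  rewrite -(eqP (yx j)) /coltot -prodrXr; apply: eq_bigr => i _.
  congr (_ ^+ _); have := s01 j; rewrite !mxE => s01j.
  by case: (eqVneq i 0) => [->//|i0]; rewrite s01j; congr (s _ _);
     apply/val_inj; move: i i0 => [[|[|]]].
have m0 s : null_hyp s -> m s != 0.
  case=> -[s0 _] _; apply/prodf_neq0 => j _.
  by rewrite expf_neq0 // gt_eqF.
have condE s : null_hyp s ->
    cond_pmf s x = h x / \sum_(y | same_coltot y x) h y.
  move=> hs; rewrite /cond_pmf pmfE //; last by apply/forallP.
  rewrite (eq_bigr (fun y => h y * m s)) => [|y yx]; last exact: pmfE.
  by rewrite -mulr_suml -mulf_div divff ?m0 // mulr1.
by move=> hp hq; rewrite !condE.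
Qed.

End Defs.

(* Main.v *)
Require Import Defs.
From mathcomp Require Import all_boot all_order all_algebra.
From mathcomp Require Import all_classical all_reals all_analysis.
From mathcomp Require Import ring lra.

Import Order.TTheory GRing.Theory Num.Theory.
Local Open Scope ring_scope.

(* Let phi' be at least as good as phi, and del = phi' - phi.  If del <> 0,
   choose a column-total vector t of maximal Euclidean length among those whose
   fiber meets the support of del, and tilt: p_2 proportional to z^(t_j), p_1
   proportional to z^(t_j) y_j.  Up to a positive factor E(phi' - phi) is a
   polynomial in z whose top coefficient is, by Cauchy-Schwarz, the sum over the
   fiber of t of (multiplicity * del * prod_j y_j^(x_1j)); so this sum is <= 0
   for y = 1 (in H) and >= 0 for y nonincreasing and nonconstant (in K_icx, by
   Chebyshev's association inequality).  The former yields w in the fiber with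
   del w < 0, hence rejected by phi, while the points a with del a > 0 are
   accepted, so that chi_D^2(a) < chi_D^2(w).  Since chi_D^2 is quasi-convex and
   monotone along the cone, a linear form with nonincreasing coefficients g_j
   separates w strictly from all these a, and y_j = exp(s g_j) with s large makes
   the term of w dominate: a contradiction. *)

(** * Separation of finitely many vectors by elimination *)

Lemma seq_above {F : realFieldType} (L : seq F) :
  exists z, forall x, x \in L -> x < z.
Proof.
elim: L => [|x L [z zL]]; first by exists 0.
exists (Num.max z (x + 1)) => y; rewrite inE lt_max => /predU1P[->|/zL->//].
by rewrite ltrDl ltr01 orbT.
Qed.

(** Supplies the multiplier in the elimination below: [L] collects its lower bounds and [U] its
    upper bounds, and either may be empty. *)
Lemma seq_between {F : realFieldType} (L U : seq F) :
  (forall x y, x \in L -> y \in U -> x < y) ->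
  exists z, (forall x, x \in L -> x < z) /\ (forall y, y \in U -> z < y).
Proof.
elim: U => [_|y U IH LU]; first by have [z zL] := seq_above L; exists z.
have [|z [Lz zU]] := IH.
  by move=> u v uL vU; apply: LU; rewrite // inE vU orbT.
have [zy|yz] := ltP z y.
  by exists z; split=> // v; rewrite inE => /predU1P[->|/zU].
(* Since y <= z, a point above [L] and below y stays below the rest of [U] too. *)
have [t [Lt ty]] : exists t, (forall x, x \in L -> x < t) /\ t < y.
  have {}LU x : x \in L -> x < y by move=> xL; apply: LU; rewrite ?inE ?eqxx.
  elim: L LU {IH Lz} => [_|x L IH LU].
    by exists (y - 1); split=> //; rewrite ltrBlDr ltrDl ltr01.
  have [|t [Lt ty]] := IH; first by move=> u uL; apply: LU; rewrite inE uL orbT.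
  have xy : x < y by apply: LU; rewrite inE eqxx.
  exists (Num.max t ((x + y) / 2)); split; last by rewrite gt_max ty; lra.
  move=> u; rewrite inE lt_max => /predU1P[->|/Lt->//].
  by apply/orP; right; lra.
exists t; split=> // v; rewrite inE => /predU1P[->//|/zU].
by apply: lt_trans; apply: lt_le_trans yz.
Qed.

(* Fourier-Motzkin elimination of the multiplier of the last form. *)
Lemma cone_separation {F : realFieldType} {V : lmodType F} m
    (f : 'I_m -> V -> F) (P : V -> Prop) (s : seq V) :
  (forall i a u v, f i (a *: u + v) = a * f i u + f i v) ->
  (forall u v, P u -> P v -> P (u + v)) ->
  (forall a u, 0 < a -> P u -> P (a *: u)) ->
  (forall u, u \in s -> P u) ->
  (forall u, P u -> exists i, 0 < f i u) ->
  exists mu : 'I_m -> F, (forall i, 0 <= mu i) /\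
    (forall u, u \in s -> 0 < \sum_i mu i * f i u).
Proof.
elim: m f P s => [|m IH] f P s flin PD PZ sP Ppos.
  by exists (fun _ => 0); split=> // u /sP/Ppos[[]].
pose k := f ord_max.
have flinZ i a u : f i (a *: u) = a * f i u.
  have f0 : f i 0 = 0.
    by have := flin i 1 0 0; rewrite scale1r addr0 mul1r; lra.
  by rewrite -[X in f i X]addr0 flin f0 addr0.
have fD i u v : f i (u + v) = f i u + f i v.
  by rewrite -[X in f i (X + _)]scale1r flin mul1r.
(* [k] vanishes on each of these combinations, so [s'] lies in the part of [P] where [k] is
   nonpositive; there the positive form must be one of the first m. *)
pose pairs := [seq - k v *: u + k u *: v | u <- [seq u <- s | 0 < k u],
                                           v <- [seq v <- s | k v < 0]].
pose s' := [seq u <- s | k u <= 0] ++ pairs.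
have [||||mu [mu0 mus]] := IH (fun i => f (widen_ord (leqnSn m) i))
    (fun u => P u /\ k u <= 0) s' (fun i => flin _).
- move=> u v [Pu ku] [Pv kv]; split; first exact: PD.
  by rewrite /k fD -/(k u) -/(k v); lra.
- move=> a u a0 [Pu ku]; split; first exact: PZ.
  by rewrite /k flinZ pmulr_rle0.
- move=> u; rewrite mem_cat mem_filter => /orP[/andP[ku /sP Pu]//|].
  case/allpairsP => -[a b] /=; rewrite !mem_filter => -[/andP[ka /sP Pa] /andP[kb /sP Pb] ->].
  split; first by apply: PD; apply: PZ; rewrite // oppr_gt0.
  by rewrite /k fD !flinZ -/(k a) -/(k b); lra.
- move=> u [Pu ku]; have [i fi] := Ppos u Pu.
  have im : (i < m)%N.
    rewrite ltn_neqAle -ltnS ltn_ord andbT; apply/negP => /eqP im.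
    have : i = ord_max by apply/val_inj.
    by move=> iE; move: fi; rewrite iE ltNge -/(k u) ku.
  by exists (Ordinal im); congr (0 < f _ u): fi; apply/val_inj.
pose g u := \sum_i mu i * f (widen_ord (leqnSn m) i) u.
have gD a b u v : g (a *: u + b *: v) = a * g u + b * g v.
  rewrite /g !mulr_sumr -big_split /=; apply: eq_bigr => i _.
  by rewrite fD !flinZ; ring.
(* Positivity of g u + z k u bounds z from below where [k] is positive and from above where it is
   negative; the entry 0 makes z positive. Positivity of [g] on [s'] makes these bounds
   compatible. *)
have [|z [Lz zU]] := @seq_between F
   (0 :: [seq - g u / k u | u <- s & 0 < k u])
   [seq - g v / k v | v <- s & k v < 0].
  move=> x y; rewrite inE => xL /mapP[v]; rewrite mem_filter => /andP[kv vs] ->.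
  case/predU1P: xL => [->|/mapP[u]].
    rewrite mulNr oppr_gt0 nmulr_llt0 ?invr_lt0//.
    by apply: (mus v); rewrite mem_cat mem_filter (ltW kv) vs.
  rewrite mem_filter => /andP[ku us] ->.
  have : 0 < g (- k v *: u + k u *: v).
    apply: mus; rewrite mem_cat; apply/orP; right; apply/allpairsP.
    by exists (u, v); rewrite /= !mem_filter ku kv us vs.
  rewrite gD ltr_pdivrMr// mulrAC ltr_ndivlMr//; lra.
have z0 : 0 < z by apply: Lz; rewrite inE eqxx.
exists (fun i => if unlift ord_max i is Some j then mu j else z); split.
  by move=> i; case: unliftP => //; rewrite ltW.
move=> u us; rewrite big_ord_recr /= unlift_none -/(k u).
have -> : \sum_(i < m) (if unlift ord_max (widen_ord (leqnSn m) i) is Some j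
   then mu j else z) * f (widen_ord (leqnSn m) i) u = g u.
  apply: eq_bigr => i _; rewrite -[widen_ord _ _](_ : lift ord_max i = _) ?liftK//.
  by apply/val_inj => /=; rewrite /bump leqNgt ltn_ord.
have [ku|ku|ku] := ltgtP (k u) 0.
- have : z < - g u / k u by apply/zU/mapP; exists u; rewrite // mem_filter ku.
  by rewrite ltr_ndivlMr//; lra.
- have : - g u / k u < z.
    by apply/Lz; rewrite inE; apply/orP; right; apply/mapP; exists u; rewrite // mem_filter ku.
  by rewrite ltr_pdivrMr//; lra.
- rewrite ku mulr0 addr0; apply: (mus u).
  by rewrite mem_cat mem_filter ku lexx us.
Qed.

(** * Coefficients of the forms that define the alternative *)

(** The last cell does not occur in the form: its index lies outside ['I_C.-1], so [insub] fails and
    the weight is 0. *)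
Definition icx_weight {R : realType} {C : nat} (lambda : 'I_C.-1 -> R)
    (r : 'I_C.-1) (j : 'I_C) : R :=
  if (j <= r)%N then lambda r
  else if insub (val j) is Some k then lambda k else 0.

Lemma icx_formE {R : realType} {C : nat} (lambda : 'I_C.-1 -> R) r v :
  icx_form lambda r v = \sum_j icx_weight lambda r j * v j.
Proof.
rewrite (bigID (fun j : 'I_C => (j <= r)%N)) /=; congr (_ + _).
  by rewrite mulr_sumr; apply: eq_bigr => j jr; rewrite /icx_weight jr.
case: C lambda r v => [|C] lambda r v; first by case: r.
rewrite [LHS]big_mkcond [RHS]big_mkcond big_ord_recr /=.
have -> : icx_weight lambda r (@ord_max C) * v ord_max = 0.
  by rewrite /icx_weight leqNgt ltn_ord /= insubF ?ltnn// mul0r.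
rewrite if_same addr0; apply: eq_bigr => j _; rewrite -ltnNge.
case: ifPn => // rj; rewrite /icx_weight leqNgt rj /= valK.
by congr (_ * v _); apply/val_inj.
Qed.

(** A plateau at [lambda r], then decreasing values, then 0, which positivity puts at the bottom.
    This shape makes the separating form nonincreasing and lets Chebyshev's inequality prove
    membership in [K_icx]. *)
Lemma icx_weight_anti {R : realType} {C : nat} (lambda : 'I_C.-1 -> R) :
  (forall i j : 'I_C.-1, (i < j)%N -> lambda j < lambda i) ->
  (forall i, 0 < lambda i) ->
  forall r (j k : 'I_C), (j <= k)%N -> icx_weight lambda r k <= icx_weight lambda r j.
Proof.
move=> lambda_decr lambda_gt0 r j k jk; rewrite /icx_weight.
have [kr|rk] := leqP k r; first by rewrite (leq_trans jk kr).
have [jr|rj] := leqP j r.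
  by case: insubP => [k' _ k'k|_]; rewrite ltW// lambda_decr// k'k.
case: insubP => [k' _ k'k|_]; last by case: insubP => [j' _ _|_]; rewrite // ltW.
case: insubP => [j' _ j'j|jC].
  move: jk; rewrite leq_eqVlt => /orP[/eqP jk|jk]; last by rewrite ltW// lambda_decr// k'k j'j.
  by rewrite (_ : j' = k')//; apply/val_inj; rewrite /= k'k j'j.
by have := ltn_ord k'; rewrite k'k => /(leq_ltn_trans jk) /=; rewrite (negPf jC).
Qed.

Lemma sample_row {C : nat} {n : 'I_2 -> nat} (x : sample n C) i :
  (\sum_j count_at x i j = n i)%N.
Proof. by case: x => c cP; apply/eqP; exact: (forallP cP i). Qed.

(** * Finiteness and quasi-convexity of the chi-square sum *)

Section Statistic.
Context {R : realType} {C : nat} {n : 'I_2 -> nat}.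
Implicit Types (x : sample n C) (u : 'M[R]_(2, C)).
Local Open Scope ereal_scope.

(** Division by 0 gives 0, so empty columns contribute nothing; this agrees with the extended-real
    sum only for tables that vanish there. *)
Definition chi2 x u : R :=
  (\sum_(i < 2) \sum_(j < C) u i j ^+ 2 / ((n i)%:R * (coltot x j)%:R))%R.

Lemma chi2_term_ge0 x u i j : 0 <= chi2_term x u i j.
Proof.
rewrite /chi2_term; case: ifP => _; first by case: ifP.
by rewrite lee_fin divr_ge0 ?sqr_ge0// mulr_ge0.
Qed.

Lemma sum_chi2_term x u :
  (forall i j, coltot x j = 0%N -> u i j = 0%R) ->
  \sum_(i < 2) \sum_(j < C) chi2_term x u i j = (chi2 x u)%:E.
Proof.
move=> u0; rewrite -sumEFin; apply: eq_bigr => i _.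
rewrite -sumEFin; apply: eq_bigr => j _; rewrite /chi2_term.
by case: eqP => // tj; rewrite u0// eqxx expr0n mul0r.
Qed.

Lemma sum_chi2_term_lty x u :
  \sum_(i < 2) \sum_(j < C) chi2_term x u i j < +oo ->
  forall i j, coltot x j = 0%N -> u i j = 0%R.
Proof.
move=> lty i j tj; apply/eqP/contraT => uij; move: lty.
rewrite (bigD1 i)//= (bigD1 j)//= {1}/chi2_term tj eqxx (negPf uij).
have sum0 (k : 'I_2) (Q : pred 'I_C) : 0 <= \sum_(j < C | Q j) chi2_term x u k j.
  by apply: sume_ge0 => l _; exact: chi2_term_ge0.
rewrite addye ?addye ?ltxx// gt_eqF// (lt_le_trans (ltNyr 0))//.
by apply: sume_ge0 => k _.
Qed.

(** Each square is convex with defect b(1-b)(u-v)^2. The bound by the maximum keeps strict sublevel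
    sets convex in the separation argument. *)
Lemma chi2_segment x u v (b : R) : (0 <= b <= 1)%R ->
  (chi2 x (b *: u + (1 - b) *: v)%R <= Num.max (chi2 x u) (chi2 x v))%R.
Proof.
move=> /andP[b0 b1]; rewrite (@le_trans _ _ (b * chi2 x u + (1 - b) * chi2 x v)%R)//.
  rewrite /chi2 !mulr_sumr -big_split; apply: ler_sum => i _ /=.
  rewrite !mulr_sumr -big_split; apply: ler_sum => j _ /=.
  rewrite !mxE !mulrA -mulrDl; apply: ler_wpM2r.
    by rewrite invr_ge0 mulr_ge0.
  rewrite -subr_ge0 (_ : _ - _ = b * (1 - b) * (u i j - v i j) ^+ 2)%R; last by ring.
  by rewrite mulr_ge0 ?sqr_ge0// mulr_ge0// subr_ge0.
have [m1 m2] : (chi2 x u <= Num.max (chi2 x u) (chi2 x v) /\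
  chi2 x v <= Num.max (chi2 x u) (chi2 x v))%R by rewrite !le_max !lexx orbT.
by nra.
Qed.

End Statistic.

(** * Separating a table from tables with a smaller statistic *)

Section Separation.
Context {R : realType} {C : nat} {n : 'I_2 -> nat}.
Context (lambda : 'I_C.-1 -> R).
Context (lambda_decr : forall i j : 'I_C.-1, (i < j)%N -> lambda j < lambda i).
Context (lambda_gt0 : forall i, 0 < lambda i).
Context (n_gt0 : forall i, (1 <= n i)%N).
Implicit Types (x a : sample n C) (d : 'M[R]_(2, C)).

Definition cone_form r d :=
  icx_form lambda r (fun j => d 0 j / (n 0)%:R - d 1 j / (n 1)%:R).

Lemma cone_formP r b d e :
  cone_form r (b *: d + e) = b * cone_form r d + cone_form r e.
Proof.
rewrite /cone_form !icx_formE mulr_sumr -big_split /=.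
by apply: eq_bigr => j _; rewrite !mxE; ring.
Qed.

Lemma icx_coneD b c d e : 0 <= b -> 0 <= c -> icx_cone n lambda d ->
  icx_cone n lambda e -> icx_cone n lambda (b *: d + c *: e).
Proof.
move=> b0 c0 [d1 d2 d3] [e1 e2 e3]; split.
- move=> j; rewrite !mxE.
  transitivity (b * (d 0 j + d 1 j) + c * (e 0 j + e 1 j)); first by ring.
  by rewrite d1 e1 !mulr0 addr0.
- move=> i; under eq_bigr do rewrite !mxE.
  by rewrite big_split/= -!mulr_sumr d2 e2 !mulr0 addr0.
- move=> r; rewrite -/(cone_form r _) -[c *: e]addr0 !cone_formP.
  rewrite (_ : cone_form r 0 = 0) ?addr0.
    by rewrite addr_ge0// mulr_ge0// ?d3 ?e3.
  by have := cone_formP r 1 0 0; rewrite scale1r addr0 mul1r; lra.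
Qed.

(** The differences x - a lie in a convex cone [P] on which some cone form is always positive, so a
    nonnegative combination of the forms is positive on all of them; its coefficients are
    nonincreasing because the weights are. *)
Lemma directed_chi2_separation x (s : seq (sample n C)) :
  (forall a, a \in s -> same_coltot a x /\
     (directed_chi2 lambda a < directed_chi2 lambda x)%E) ->
  exists g : 'I_C -> R, (forall j k : 'I_C, (j <= k)%N -> g k <= g j) /\
    forall a, a \in s -> \sum_j g j * (count_at a 0 j)%:R
                         < \sum_j g j * (count_at x 0 j)%:R.
Proof.
(* [P] holds the margin-free directions d such that some table above X - c d, with c > 0, beats the
   infimum at x. *)
move=> sP; pose X : 'M[R]_(2, C) := real_table x.
pose P d := [/\ forall j, d 0 j + d 1 j = 0, forall i, \sum_j d i j = 0 &
  exists c u, [/\ 0 < c, icx_cone n lambda (u - (X - c *: d)),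
    forall i j, coltot x j = 0%N -> u i j = 0
    & ((chi2 x u)%:E < directed_chi2 lambda x)%E]].
have [|d e|b d b0|d|d|mu [mu0 mus]] :=
  cone_separation (C.-1) cone_form P [seq X - real_table a | a <- s].
- exact: cone_formP.
- case=> d1 d2 [b [u [b0 ub u0 qu]]] [e1 e2 [c [v [c0 vc v0 qv]]]]; split.
  + by move=> j; rewrite !mxE addrACA d1 e1 addr0.
  + by move=> i; under eq_bigr do rewrite !mxE; rewrite big_split/= d2 e2 addr0.
  (* With this t, t (X - b d) + (1 - t) (X - c e) = X - (bc / (b + c)) (d + e), which gives the
     scale for the sum. *)
  pose t := c / (b + c).
  have bc0 : b + c != 0 by rewrite gt_eqF// addr_gt0.
  have t1 : 1 - t = b / (b + c) by rewrite /t; field.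
  have t0 : 0 <= t by rewrite divr_ge0// ?ltW// addr_gt0.
  have t'0 : 0 <= 1 - t by rewrite t1 divr_ge0// ?ltW// addr_gt0.
  exists (b * c / (b + c)), (t *: u + (1 - t) *: v); split.
  + by rewrite divr_gt0 ?mulr_gt0// addr_gt0.
  + rewrite (_ : _ - _ = t *: (u - (X - b *: d)) + (1 - t) *: (v - (X - c *: e))).
      exact: icx_coneD.
    by rewrite t1 /t; apply/matrixP => i j; rewrite !mxE; field.
  + by move=> i j tj; rewrite !mxE u0// v0//; ring.
  + apply: (@le_lt_trans _ _ (Num.max (chi2 x u) (chi2 x v))%:E).
      by rewrite lee_fin chi2_segment// t0 -subr_ge0.
    by case: (leP (chi2 x u) (chi2 x v)).
- case=> d1 d2 [c [u [c0 uc u0 qu]]]; split.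
  + by move=> j; rewrite !mxE -mulrDr d1 mulr0.
  + by move=> i; under eq_bigr do rewrite !mxE; rewrite -mulr_sumr d2 mulr0.
  exists (c / b), u; split=> //; first by rewrite divr_gt0.
  by rewrite scalerA divfK// gt_eqF.
- case/mapP => a /sP[/forallP ax lt_ax] ->.
  have tE j : (count_at x 0 j)%:R + (count_at x 1 j)%:R =
      (count_at a 0 j)%:R + (count_at a 1 j)%:R :> R.
    have := eqP (ax j); rewrite /coltot !big_ord_recl !big_ord0 !addn0.
    by rewrite (_ : lift ord0 ord0 = 1); [rewrite -!natrD => -> | apply/val_inj].
  split.
  + by move=> j; rewrite !mxE; have := tE j; lra.
  + move=> i; under eq_bigr do rewrite !mxE.
    by rewrite big_split/= sumrN -!natr_sum !sample_row subrr.
  (* For d = X - a and c = 1, X - c d is a itself; equal column totals let the terms of a be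
     computed with x. *)
  have [_ [u /= ua <-] qu] := ereal_inf_lt lt_ax.
  have xaE i j : chi2_term a u i j = chi2_term x u i j.
    by rewrite /chi2_term (eqP (ax j)).
  have {}xaE : (\sum_(i < 2) \sum_(j < C) chi2_term a u i j =
     \sum_(i < 2) \sum_(j < C) chi2_term x u i j)%E.
    by apply: eq_bigr => i _; apply: eq_bigr.
  rewrite xaE in qu.
  have u0 := sum_chi2_term_lty _ _ (lt_le_trans qu (leey _)).
  exists 1, u; split=> //; last by rewrite -sum_chi2_term.
  by rewrite scale1r subKr.
(* If every form were nonpositive at d, then -d would be in the cone and u would lie above x, with a
   value below the infimum. *)
- case=> d1 d2 [c [u [c0 uc u0 qu]]]; apply: contrapT => /forallNP dle.
  suff : (directed_chi2 lambda x <= (chi2 x u)%:E)%E by rewrite leNgt qu.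
  rewrite -(sum_chi2_term _ _ u0); apply: ereal_inf_lbound; exists u => //.
  rewrite /upper_tables /= (_ : _ - _ = 1 *: (u - (X - c *: d)) + c *: (- d)).
    apply: icx_coneD => //; rewrite ?ltW//; split.
    + by move=> j; rewrite !mxE -opprD d1 oppr0.
    + by move=> i; under eq_bigr do rewrite !mxE; rewrite sumrN d2 oppr0.
    + move=> r; rewrite -/(cone_form r _) -[- d]addr0 -scaleN1r cone_formP.
      have := cone_formP r 1 0 0; rewrite scale1r addr0 mul1r.
      by have /negP := dle r; rewrite -leNgt; lra.
  by apply/matrixP => i j; rewrite !mxE; ring.
exists (fun j => \sum_r mu r * icx_weight lambda r j); split.
  by move=> j k jk; apply: ler_sum => r _; rewrite ler_wpM2l// icx_weight_anti.
move=> a as_; have /mus dpos := map_f (fun a => X - real_table a) as_.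
have [/forallP ax _] := sP a as_.
have tE j : (count_at x 1 j)%:R - (count_at a 1 j)%:R =
    - ((count_at x 0 j)%:R - (count_at a 0 j)%:R) :> R.
  have := eqP (ax j); rewrite /coltot !big_ord_recl !big_ord0 !addn0.
  rewrite (_ : lift ord0 ord0 = 1); last exact/val_inj.
  by move=> /(congr1 (fun k => k%:R : R)); rewrite !natrD; lra.
(* The rows of X - a are opposite, so d_1/n_1 - d_2/n_2 = K d_1. *)
pose K : R := (n 0)%:R^-1 + (n 1)%:R^-1.
have K0 : 0 < K by rewrite addr_gt0// invr_gt0 ltr0n n_gt0.
rewrite -subr_gt0 -sumrB -(pmulr_rgt0 _ K0); congr (0 < _) : dpos.
under eq_bigr do rewrite /cone_form icx_formE mulr_sumr.
rewrite exchange_big mulr_sumr; apply: eq_bigr => j _ /=.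
rewrite -mulrBr mulrCA mulr_suml; apply: eq_bigr => r _.
by rewrite !mxE tE /K; ring.
Qed.

End Separation.

(** * Dominant terms of polynomials and exponential sums *)

Lemma top_coef_ge0 {F : realFieldType} {I : finType} (c : I -> F) (e : I -> nat)
    (D : nat) :
  (forall z, 0 < z -> 0 <= \sum_x c x * z ^+ e x) ->
  (forall x, c x != 0 -> (e x <= D)%N) ->
  0 <= \sum_(x | e x == D) c x.
Proof.
move=> c_ge0 eD; rewrite leNgt; apply/negP => S0.
set S := \sum_(x | _) _ in S0.
pose K := \sum_(x | e x != D) `|c x|.
have K0 : 0 <= K by apply: sumr_ge0.
(* This z gives S z + K = S < 0. Multiplied by z, the remaining terms total at most K z^D, because z
   >= 1 and their degrees are below D. *)
pose z := K / - S + 1.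
have z1 : 1 <= z by rewrite lerDr divr_ge0// oppr_ge0 ltW.
have z0 : 0 < z by apply: lt_le_trans z1.
have Sz : S * z + K = S by rewrite /z; field; rewrite lt_eqF.
have := c_ge0 z z0; rewrite -(pmulr_rge0 _ z0) leNgt => /negP; apply.
rewrite (bigID (fun x => e x == D)) /= mulrDr.
apply: (@le_lt_trans _ _ (z * (S * z ^+ D) + K * z ^+ D)).
  apply: lerD; first by rewrite ler_pM2l// mulr_suml; apply: ler_sum => x /eqP ->.
  rewrite mulr_sumr mulr_suml; apply: ler_sum => x exD.
  have [->|cx] := eqVneq (c x) 0; first by rewrite normr0 !mul0r mulr0.
  rewrite mulrCA -exprS (@le_trans _ _ (`|c x| * z ^+ (e x).+1))//.
    by rewrite ler_wpM2r ?ler_norm// exprn_ge0// ltW.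
  by rewrite ler_wpM2l// ler_weXn2l// ltn_neqAle exD eD.
rewrite mulrA -mulrDl [z * S]mulrC Sz nmulr_rlt0//.
by rewrite exprn_gt0.
Qed.

(** Only positive terms can hurt. After division by exp(s g(x0)) and multiplication by s, 1 + u <=
    exp u bounds such a term by c x / (g x0 - g x), free of s; then s is chosen so that c x0
    outweighs their sum. *)
Lemma exp_sum_lt0 {R : realType} {I : finType} (Q : pred I) (c g : I -> R) x0 :
  Q x0 -> c x0 < 0 -> (forall x, Q x -> 0 < c x -> g x < g x0) ->
  exists2 s, 0 < s & \sum_(x | Q x) c x * expR (s * g x) < 0.
Proof.
move=> Qx0 cx0 gx.
pose b x := if 0 < c x then c x / (g x0 - g x) else 0.
pose K := \sum_(x | Q x && (x != x0)) b x.
have b0 x : Q x -> 0 <= b x.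
  move=> Qx; rewrite /b; case: ifP => // cx.
  by rewrite divr_ge0// ltW// subr_gt0 gx.
have K0 : 0 <= K by apply: sumr_ge0 => x /andP[/b0].
pose s := K / - c x0 + 1.
have s0 : 0 < s by rewrite ltr_wpDl// divr_ge0// oppr_ge0 ltW.
have sE : c x0 * s + K = c x0 by rewrite /s; field; rewrite lt_eqF.
have EE x : expR (s * g x) * expR (- (s * g x0)) = (expR (s * (g x0 - g x)))^-1.
  by rewrite -expRD -expRN; congr expR; ring.
exists s => //; rewrite -(pmulr_llt0 _ (expR_gt0 (- (s * g x0)))) -(pmulr_rlt0 _ s0).
rewrite mulr_suml mulr_sumr (bigD1 x0)//=.
apply: (@le_lt_trans _ _ (c x0 * s + K)); last by rewrite sE.
apply: lerD; first by rewrite -mulrA EE subrr mulr0 expR0 invr1 mulr1 mulrC.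
apply: ler_sum => x /andP[Qx _]; rewrite -mulrA EE /b; case: ifPn => cx; last first.
  rewrite pmulr_rle0// mulr_le0_ge0 ?invr_ge0 ?expR_ge0//.
  by rewrite leNgt.
have gap : 0 < g x0 - g x by rewrite subr_gt0 gx.
rewrite mulrCA ler_pM2l// ler_pdivrMr ?expR_gt0// mulrC ler_pdivlMr//.
by have := expR_ge1Dx (s * (g x0 - g x)); lra.
Qed.

(** * Tilted parameters in the hypothesis and the alternative *)

Section Tilting.
Context {R : realType} {C : nat}.
Implicit Types q y v : 'I_C -> R.

(** Up to normalisation y is the ratio of row 0 to row 1, while q is common to both rows. *)
Definition tilted q y : 'M[R]_(2, C) :=
  let w i j := q j * (if i == 0 then y j else 1) in
  \matrix_(i, j) (w i j / \sum_k w i k).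

Lemma tilted_weight_gt0 q y (i : 'I_2) j : (forall j, 0 < q j) -> (forall j, 0 < y j) ->
  0 < q j * (if i == 0 then y j else 1).
Proof. by move=> q0 y0; rewrite mulr_gt0//; case: ifP. Qed.

Lemma tilted_total_gt0 q y (i : 'I_2) : (0 < C)%N ->
  (forall j, 0 < q j) -> (forall j, 0 < y j) ->
  0 < \sum_k q k * (if i == 0 then y k else 1).
Proof.
move=> C0 q0 y0; rewrite (bigD1 (Ordinal C0))//= ltr_wpDr ?tilted_weight_gt0//.
by apply: sumr_ge0 => k _; rewrite ltW// tilted_weight_gt0.
Qed.

Lemma tilted_cell_probs q y : (0 < C)%N ->
  (forall j, 0 < q j) -> (forall j, 0 < y j) -> cell_probs (tilted q y).
Proof.
move=> C0 q0 y0; split=> [i j|i].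
  by rewrite mxE divr_gt0 ?tilted_total_gt0 ?tilted_weight_gt0.
under eq_bigr do rewrite mxE.
by rewrite -mulr_suml divff// gt_eqF// tilted_total_gt0.
Qed.

Lemma tilted_null q : (0 < C)%N -> (forall j, 0 < q j) ->
  null_hyp (tilted q (fun=> 1)).
Proof.
move=> C0 q0; split; first exact: tilted_cell_probs.
by apply/rowP => j; rewrite !mxE /=.
Qed.

(* Symmetrizing in [j, k] gives the terms [q j * q k * (v j - v k) * (y j - y k)]. *)
Lemma chebyshev_sum q v y : (forall j, 0 < q j) ->
  (forall j k : 'I_C, (j <= k)%N -> v k <= v j) ->
  (forall j k : 'I_C, (j <= k)%N -> y k <= y j) ->
  (\sum_j v j * q j) * (\sum_j q j * y j) <= (\sum_j v j * (q j * y j)) * (\sum_j q j).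
Proof.
move=> q0 vdecr ydecr; rewrite -subr_ge0.
pose T j k := q j * q k * v j * (y j - y k).
have -> : (\sum_j v j * (q j * y j)) * (\sum_j q j) -
   (\sum_j v j * q j) * (\sum_j q j * y j) = \sum_j \sum_k T j k.
  rewrite !mulr_suml -sumrB; apply: eq_bigr => j _.
  by rewrite !mulr_sumr -sumrB; apply: eq_bigr => k _; rewrite /T; ring.
suff : 0 <= \sum_j \sum_k T j k + \sum_j \sum_k T j k by lra.
rewrite {2}exchange_big -big_split; apply: sumr_ge0 => j _ /=.
rewrite -big_split; apply: sumr_ge0 => k _ /=.
rewrite (_ : T j k + T k j = q j * q k * ((v j - v k) * (y j - y k))); last by rewrite /T; ring.
apply: mulr_ge0; first by rewrite mulr_ge0 ?(ltW (q0 _)).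
have [jk|/ltnW kj] := leqP j k; first by rewrite mulr_ge0// subr_ge0 ?vdecr ?ydecr.
by rewrite mulr_le0// subr_le0 ?vdecr ?ydecr.
Qed.

(** After clearing the two normalisers, each inequality is Chebyshev's with the nonincreasing
    weights of the form. *)
Lemma tilted_K_icx (lambda : 'I_C.-1 -> R) q y (a b : 'I_C) :
  (forall i j : 'I_C.-1, (i < j)%N -> lambda j < lambda i) ->
  (forall i, 0 < lambda i) ->
  (forall j, 0 < q j) -> (forall j, 0 < y j) ->
  (forall j k : 'I_C, (j <= k)%N -> y k <= y j) -> y a != y b ->
  K_icx lambda (tilted q y).
Proof.
move=> lambda_decr lambda_gt0 q0 y0 ydecr yab.
have C0 : (0 < C)%N by case: C a {b yab} => [[]|].
have Z0 := tilted_total_gt0 q y 0 C0 q0 y0.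
have Z1 := tilted_total_gt0 q y 1 C0 q0 y0.
split; last first.
  case=> _ /rowP e; case/eqP: yab.
  (* Equal rows force y to be the constant ratio of the normalisers. *)
  suff ye j : y j = (\sum_k q k * y k) / (\sum_k q k * 1) by rewrite !ye.
  have := e j; rewrite !mxE /= => ej.
  apply: (mulfI (lt0r_neq0 (q0 j))).
  move: ej => /(congr1 (fun r => r * (\sum_k q k * y k))).
  rewrite divfK ?gt_eqF// => ->; ring.
split; first exact: tilted_cell_probs.
move=> r; rewrite icx_formE.
set W := icx_weight lambda r.
have qE : \sum_k q k * 1 = \sum_k q k by apply: eq_bigr => k _; rewrite mulr1.
have -> : \sum_j W j * (tilted q y 0 j - tilted q y 1 j) =
   (\sum_j W j * (q j * y j)) / (\sum_j q j * y j) - (\sum_j W j * q j) / (\sum_j q j).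
  rewrite !mulr_suml -sumrB; apply: eq_bigr => j _; rewrite !mxE /=.
  by rewrite qE mulr1 mulrBr !mulrA.
rewrite /= in Z0; rewrite /= qE in Z1.
rewrite subr_ge0 ler_pdivrMr// mulrAC ler_pdivlMr//.
by apply: chebyshev_sum => //; exact: icx_weight_anti.
Qed.

End Tilting.

(** * Multinomial likelihoods and conditional P-values *)

Section Multinomial.
Context {R : realType} {C : nat} {n : 'I_2 -> nat}.
Implicit Types (x a : sample n C) (p : 'M[R]_(2, C)) (phi : sample n C -> R).

Definition multiplicity x : R :=
  \prod_(i < 2) ((n i)`!%:R / \prod_(j < C) (count_at x i j)`!%:R).

Lemma multiplicity_gt0 x : 0 < multiplicity x.
Proof.
apply: prodr_gt0 => i _; rewrite divr_gt0 ?ltr0n ?fact_gt0//.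
by apply: prodr_gt0 => j _; rewrite ltr0n fact_gt0.
Qed.

(** The factor q enters through column totals only and y through row 0 only; the normalisers have
    the fixed row totals as exponents, so K is the same for all x. *)
Lemma pmf_tilted (q y : 'I_C -> R) : (0 < C)%N ->
  (forall j, 0 < q j) -> (forall j, 0 < y j) ->
  exists2 K, 0 < K & forall x, Defs.pmf (tilted q y) x =
   K * (multiplicity x * ((\prod_j q j ^+ coltot x j) * \prod_j y j ^+ count_at x 0 j)).
Proof.
move=> C0 q0 y0; pose Z i := \sum_k q k * (if i == 0 :> 'I_2 then y k else 1).
have Z0 i : 0 < Z i by exact: tilted_total_gt0.
exists (\prod_i (Z i ^- n i)) => [|x].
  by apply: prodr_gt0 => i _; rewrite invr_gt0 exprn_gt0.
rewrite /Defs.pmf big_split /= -/(multiplicity x) mulrCA; congr (_ * _).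
have -> : (\prod_j q j ^+ coltot x j) * \prod_j y j ^+ count_at x 0 j =
    \prod_(i < 2) \prod_j (q j * (if i == 0 then y j else 1)) ^+ count_at x i j.
  rewrite exchange_big /= -big_split /=; apply: eq_bigr => j _.
  rewrite /coltot !big_ord_recl !big_ord0 /= addn0 !mulr1 exprD exprMn.
  by rewrite mulrAC.
rewrite -big_split; apply: eq_bigr => i _ /=.
rewrite -(sample_row x i) -prodrXr -prodfV -big_split; apply: eq_bigr => j _ /=.
by rewrite mxE expr_div_n mulrC.
Qed.

Lemma pmf_ge0 p x : cell_probs p -> 0 <= Defs.pmf p x.
Proof.
case=> p0 _; apply: prodr_ge0 => i _; apply: mulr_ge0.
  by rewrite divr_ge0//; apply: prodr_ge0.
by apply: prodr_ge0 => j _; rewrite exprn_ge0// ltW.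
Qed.

Lemma cond_pmf_ge0 p x : cell_probs p -> 0 <= cond_pmf p x.
Proof.
move=> hp; rewrite divr_ge0 ?pmf_ge0//.
by apply: sumr_ge0 => y _; exact: pmf_ge0.
Qed.

Lemma same_coltot_eq a x : same_coltot a x -> coltot a = coltot x.
Proof. by move=> /forallP ax; apply/funext => j; exact/eqP. Qed.

(** Within a fiber, a larger statistic sums the same conditional masses over a smaller tail. *)
Lemma pvalue_anti (lambda : 'I_C.-1 -> R) p a x : cell_probs p -> same_coltot a x ->
  (directed_chi2 lambda x <= directed_chi2 lambda a)%E ->
  pvalue lambda p a <= pvalue lambda p x.
Proof.
move=> hp /same_coltot_eq ax xa; rewrite /pvalue big_mkcond [leRHS]big_mkcond.
apply: ler_sum => y _; case: ifPn => [/andP[ya ay]|_].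
  by rewrite (le_trans xa ay) andbT /same_coltot -ax -/(same_coltot y a) ya.
by case: ifP => // _; exact: cond_pmf_ge0.
Qed.

End Multinomial.

(** * Maximal column totals and the proof of admissibility *)

(** Sum 2 t u <= t^2 + u^2 over the index; equality of the sums forces equality in every term. *)
Lemma dotprod_max {I : finType} (t u : I -> nat) :
  (\sum_j u j ^ 2 <= \sum_j t j ^ 2)%N ->
  (\sum_j t j * u j <= \sum_j t j ^ 2)%N /\
  ((\sum_j t j * u j)%N = (\sum_j t j ^ 2)%N -> u =1 t).
Proof.
move=> ut.
have [le_tu eq_tu] := leqif_sum (P := predT) (fun j _ => nat_Cauchy (t j) (u j)).
rewrite -big_distrr big_split /= in le_tu eq_tu.
have le2 : (\sum_j t j ^ 2 + \sum_j u j ^ 2 <= 2 * \sum_j t j ^ 2)%N.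
  by rewrite mul2n -addnn leq_add2l.
split; first by rewrite -(leq_pmul2l (isT : (0 < 2)%N)) (leq_trans le_tu).
move=> e; have : [forall j, t j == u j].
  by rewrite -eq_tu eqn_leq le_tu e.
by move=> /forallP tu j; rewrite (eqP (tu j)).
Qed.

Theorem mainTheorem2 (R : realType) (C : nat) (hC : (2 <= C)%N)
  (lambda : 'I_C.-1 -> R)
  (lambda_decr : forall i j : 'I_C.-1, (i < j)%N -> lambda j < lambda i)
  (lambda_gt0 : forall i, 0 < lambda i)
  (n : 'I_2 -> nat) (n_gt0 : forall i, (1 <= n i)%N)
  (alpha : R) (alpha_gt0 : 0 < alpha) (alpha_lt1 : alpha < 1)
  (p0 : 'M[R]_(2, C)) (hp0 : null_hyp p0) :
  admissible null_hyp (K_icx lambda)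
    (directed_chi2_test (n := n) lambda p0 alpha).
Proof.
set phi := directed_chi2_test _ _ _.
split; first by move=> x; rewrite /phi /directed_chi2_test; case: ifP => _; rewrite ?lexx ?ler01.
case=> phi' [test' leH geK strict].
pose del x := phi' x - phi x.
have C0 : (0 < C)%N by apply: leq_trans hC.
have expectB p : expect p phi' - expect p phi = \sum_x Defs.pmf p x * del x.
  by rewrite /expect -sumrB; apply: eq_bigr => x _; rewrite mulrBr.
have [xs del_xs] : exists x, del x != 0.
  apply: contrapT => /forallNP del0.
  have eqE p : expect p phi' - expect p phi = 0.
    rewrite expectB big1// => x _.
    by have /negP/negbNE/eqP -> := del0 x; rewrite mulr0.
  by case: strict => -[p _]; have := eqE p; lra.
pose sq (x : sample n C) := (\sum_j coltot x j ^ 2)%N.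
have [x0 del_x0 x0_max] := arg_maxnP sq (del_xs : [pred x | del x != 0] xs).
pose t := coltot x0.
pose e (x : sample n C) := (\sum_j t j * coltot x j)%N.
(* Tables of degree [sq x0] outside the fiber of [x0] have [del] = 0, so the top coefficient only
   sees the fiber. *)
have e_max x : del x != 0 ->
    (e x <= sq x0)%N /\ (e x = sq x0 -> same_coltot x x0).
  move=> dx; have [le_e eq_e] := dotprod_max t (coltot x) (x0_max x dx).
  by split=> // /eq_e ex; apply/forallP => j; rewrite ex.
pose q (z : R) (j : 'I_C) := z ^+ t j.
have q_gt0 z : 0 < z -> forall j, 0 < q z j by move=> z0 j; rewrite exprn_gt0.
have qE z x : \prod_j q z j ^+ coltot x j = z ^+ e x.
  by rewrite /e -prodrXr; apply: eq_bigr => j _; rewrite exprM.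
pose coef (y : 'I_C -> R) x :=
  multiplicity x * del x * \prod_j y j ^+ count_at x 0 j.
have sumE y : (forall j, 0 < y j) -> forall z, 0 < z -> exists2 K, 0 < K &
    expect (tilted (q z) y) phi' - expect (tilted (q z) y) phi =
    K * \sum_x coef y x * z ^+ e x.
  move=> y0 z z0; have [K K0 pmfE] := @pmf_tilted _ _ n (q z) y C0 (q_gt0 z z0) y0.
  exists K => //; rewrite expectB mulr_sumr; apply: eq_bigr => x _.
  by rewrite pmfE qE /coef; ring.
have coef_max y x : coef y x != 0 -> (e x <= sq x0)%N.
  rewrite /coef => cx; apply: (proj1 (e_max x _)).
  by apply: contraNneq cx => ->; rewrite mulr0 mul0r.
have null_le : \sum_(x | e x == sq x0) multiplicity x * del x <= 0.
  have := @top_coef_ge0 R _ (fun x => - coef (fun=> 1) x) e (sq x0).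
  have -> : \sum_(x | e x == sq x0) - coef (fun=> 1) x =
     - \sum_(x | e x == sq x0) multiplicity x * del x.
    rewrite -sumrN; apply: eq_bigr => x _; rewrite /coef big1 ?mulr1// => j _.
    by rewrite expr1n.
  rewrite oppr_ge0; apply=> [z z0|x]; last by rewrite oppr_eq0; exact: coef_max.
  have [//|K K0 dE] := sumE (fun=> 1) _ z z0.
  have := leH _ (tilted_null (q z) C0 (q_gt0 z z0)).
  rewrite -subr_le0 dE pmulr_rle0// => S0.
  by under eq_bigr do rewrite mulNr; rewrite sumrN oppr_ge0.
have alt_ge y (a b : 'I_C) : (forall j, 0 < y j) ->
    (forall j k : 'I_C, (j <= k)%N -> y k <= y j) -> y a != y b ->
    0 <= \sum_(x | e x == sq x0) coef y x.
  move=> y0 ydecr yab; apply: top_coef_ge0 (coef_max y) => z z0.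
  have [K K0 dE] := sumE y y0 z z0.
  have := geK _ (tilted_K_icx _ _ _ a b lambda_decr lambda_gt0 (q_gt0 z z0) y0 ydecr yab).
  by rewrite -subr_ge0 dE pmulr_rge0.
have [x1 ex1 del_x1] : exists2 x1, e x1 == sq x0 & del x1 < 0.
  apply: contrapT => no_x1; move: null_le; apply/negP; rewrite -ltNge.
  have ge0 x : e x == sq x0 -> 0 <= multiplicity x * del x.
    move=> ex; apply: mulr_ge0; first exact/ltW/multiplicity_gt0.
    by rewrite leNgt; apply/negP => dx; apply: no_x1; exists x.
  have ex0 : e x0 == sq x0 by apply/eqP; apply: eq_bigr => j _; rewrite mulnn.
  (* A zero sum of nonnegative terms would make the term of [x0] vanish, against [del x0 != 0]. *)
  rewrite lt_neqAle sumr_ge0// andbT eq_sym; apply/eqP => S0.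
  have /eqP := psumr_eq0P ge0 S0 ex0.
  by rewrite mulf_eq0 gt_eqF ?multiplicity_gt0// (negPf del_x0).
have x1x0 : same_coltot x1 x0.
  by apply: (proj2 (e_max x1 _) (eqP ex1)); rewrite lt_eqF.
have phi01 x : phi x = if pvalue lambda p0 x <= alpha then 1 else 0 by [].
pose acc := [seq x <- enum {: sample n C} | (e x == sq x0) && (0 < del x)].
have accP a : a \in acc -> same_coltot a x1 /\
    (directed_chi2 lambda a < directed_chi2 lambda x1)%E.
  rewrite mem_filter => /andP[/andP[ea da] _].
  have ax0 : same_coltot a x0.
    by apply: (proj2 (e_max a _) (eqP ea)); rewrite gt_eqF.
  have ax1 : same_coltot a x1.
    apply/forallP => j.
    by rewrite (eqP (forallP ax0 j)) (eqP (forallP x1x0 j)).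
  split=> //; rewrite ltNge; apply/negP => x1a.
  have /pvalue_anti := hp0.1.
  move=> /(_ _ lambda a x1 ax1 x1a) le_p.
  (* As phi' takes values in [0,1], [del a > 0] forces phi a = 0 and [del x1 < 0] forces phi x1 = 1,
     so the P-value of a exceeds alpha while that of [x1] does not. *)
  have := test' a; have := test' x1.
  move: da del_x1; rewrite /del !phi01.
  case: ifP => [_|/negbT]; first by lra.
  rewrite -ltNge => alpha_a; case: ifP => [alpha_x|_]; last by lra.
  by move: (lt_le_trans alpha_a (le_trans le_p alpha_x)); rewrite ltxx.
have [g [gdecr [[a [b gab]] gsep]]] : exists g : 'I_C -> R,
    (forall j k : 'I_C, (j <= k)%N -> g k <= g j) /\
    ((exists a b, g a != g b) /\
    (forall a, a \in acc -> \sum_j g j * (count_at a 0 j)%:R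
                          < \sum_j g j * (count_at x1 0 j)%:R)).
  case: acc accP => [_|a0 acc accP].
    (* With nothing to separate, any nonconstant nonincreasing g serves; two cells exist by [hC]. *)
    exists (fun j => (j == 0 :> nat)%:R); split.
      by move=> [[|j] ?] [[|k] ?] //= _; rewrite ?ler01.
    split=> //; exists (Ordinal C0), (Ordinal hC) => /=.
    by rewrite oner_eq0.
  have [g [gdecr gsep]] := directed_chi2_separation _ lambda_decr lambda_gt0 n_gt0 x1 _ accP.
  (* A constant g would give all tables the same value, since row 0 has a fixed total; this
     contradicts strict separation. *)
  exists g; split=> //; split=> //; apply: contrapT => /forallNP gconst.
  have {}gconst j : g j = g (Ordinal C0).
    by apply/eqP/negbNE/negP => gj; apply: (gconst j); exists (Ordinal C0).
  have gE (x : sample n C) : \sum_j g j * (count_at x 0 j)%:R = g (Ordinal C0) * (n 0)%:R.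
    by under eq_bigr do rewrite gconst; rewrite -mulr_sumr -natr_sum sample_row.
  by have := gsep a0 (mem_head _ _); rewrite !gE ltxx.
have [||s s0] := @exp_sum_lt0 R _ (fun x => e x == sq x0)
  (fun x => multiplicity x * del x) (fun x => \sum_j g j * (count_at x 0 j)%:R) x1 ex1.
- by rewrite pmulr_rlt0 ?multiplicity_gt0.
- move=> a' ea'; rewrite pmulr_rgt0 ?multiplicity_gt0// => da'.
  by apply: gsep; rewrite mem_filter ea' da' mem_enum.
pose y j := expR (s * g j).
have coefE x : coef y x =
    multiplicity x * del x * expR (s * \sum_j g j * (count_at x 0 j)%:R).
  rewrite mulr_sumr expR_sum; congr (_ * _); apply: eq_bigr => j _.
  by rewrite mulrA expRM_natr.
under eq_bigr do rewrite -coefE.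
rewrite ltNge => /negP; apply; apply: (alt_ge y a b).
- by move=> j; exact: expR_gt0.
- by move=> j k jk; rewrite ler_expR ler_pM2l// gdecr.
- by apply: contra gab => /eqP/expR_inj/(mulfI (lt0r_neq0 s0)) ->.
Qed.
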